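(* Let $F$ be a complete alternating shape with $n$ pipes and let $P$ be a reduced pipe dream on $F$ with exit permutation $\omega$. Then for any $1\le p<q\le n$ such that $(p,q)$ is a noninversion of $\omega$, there is a directed path from $p$ to $q$ in the contact graph of $P$.
   Context: Grid cells are unit squares with corners in $\mathbb Z^2$, indexed by their lower-left corner. An alternating shape $F$ (with parameter $n\ge 2$) is a connected finite set of cells whose boundary splits into four paths: a starting path from $(0,0)$ made of $n$ unit steps, each south or east; a NW stair path from $(0,0)$ to $(t_F,t_F)$ with steps $(NE)^{t_F}$, $t_F\ge 0$; an ending path from $(t_F,t_F)$ made of $n$ unit steps, each south or east; and a SE stair path from the endpoint of the starting path to the endpoint of the ending path with steps $(EN)^{b}$, $b\ge0$; the ending path stays strictly north and east of the starting path. A pipe dream on $F$ fills each cell with either a cross (one pipe passing straight horizontally, one straight vertically) or a contact (one elbow joining the west side to the north side, called the NW elbow, and one joining the south side to the east side, called the SE elbow), so that the $n$ pipes entering through the $n$ unit steps of the starting path exit through the $n$ unit steps of the ending path. Pipes are labelled $1,\dots,n$ by their entry step, from northwest to southeast along the starting path; the exit permutation $\omega$ is given by: $\omega(i)$ is the pipe exiting through the $i$-th step of the ending path (counted from northwest to southeast). A pipe dream is reduced if any two pipes cross at most once. A permutation is sortable on $F$ if some (reduced) pipe dream on $F$ has it as exit permutation; $F$ is complete if the longest permutation $\omega_0=n\,(n-1)\cdots 2\,1$ is sortable on $F$. For $a<b$, $(a,b)$ is a noninversion of $\omega$ if $\omega^{-1}(a)<\omega^{-1}(b)$. The contact graph of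 $P$ is the directed graph on $\{1,\dots,n\}$ with an arc $a\to b$ iff some contact cell of $P$ has pipe $a$ on its NW elbow and pipe $b$ on its SE elbow. *)

(* Defs.v *)
From Stdlib Require Import Relation_Operators.
From mathcomp Require Import all_boot all_order all_algebra all_fingroup.
From mathcomp Require Import finmap.

Set Implicit Arguments.
Unset Strict Implicit.
Unset Printing Implicit Defensive.

Import GRing.Theory Num.Theory.

Local Open Scope ring_scope.

Definition point : Type := (int * int)%type.

(* A cell is represented by its lower-left corner. *)
Definition cell : Type := (int * int)%type.

(* A unit edge of the grid: [(true, c)] is the west side of the cell [c] and
   [(false, c)] is its south side. *)
Definition edge : Type := (bool * (int * int))%type.

Definition west_side (c : cell) : edge := (true, c).
Definition south_side (c : cell) : edge := (false, c).
Definition east_side (c : cell) : edge := (true, (c.1 + 1, c.2)).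
Definition north_side (c : cell) : edge := (false, (c.1, c.2 + 1)).

(* The two cells separated by an edge: the one to its east or north, which a
   pipe going through the edge enters, and the one to its west or south, which
   this pipe leaves. *)
Definition cell_after (e : edge) : cell := e.2.
Definition cell_before (e : edge) : cell :=
  if e.1 then (e.2.1 - 1, e.2.2) else (e.2.1, e.2.2 - 1).

Variant direction := North | East | South.

Definition move (p : point) (d : direction) : point :=
  match d with
  | North => (p.1, p.2 + 1)
  | East => (p.1 + 1, p.2)
  | South => (p.1, p.2 - 1)
  end.

Definition step_edge (p : point) (d : direction) : edge :=
  match d with
  | North => (true, p)
  | East => (false, p)
  | South => (true, (p.1, p.2 - 1))
  end.

Definition path_end (p : point) (w : seq direction) : point := foldl move p w.

Definition path_vertex (p : point) (w : seq direction) (i : nat) : point :=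
  path_end p (take i w).

Definition path_edge (p : point) (w : seq direction) (i : nat) : edge :=
  step_edge (path_vertex p w i) (nth South w i).

Definition path_edges (p : point) (w : seq direction) : seq edge :=
  [seq path_edge p w i | i <- iota 0 (size w)].

Definition stair (d1 d2 : direction) (k : nat) : seq direction :=
  flatten (nseq k [:: d1; d2]).

Definition adjacent (c c' : cell) : bool :=
  c' \in [:: (c.1 + 1, c.2); (c.1 - 1, c.2); (c.1, c.2 + 1); (c.1, c.2 - 1)].

Definition connected_cells (F : {fset (int * int)}) : Prop :=
  forall c c' : cell, c \in F -> c' \in F ->
    clos_refl_trans cell
      (fun a b => [/\ a \in F, b \in F & adjacent a b]) c c'.

Definition boundary_edge (F : {fset (int * int)}) (e : edge) : bool :=
  (cell_before e \in F) != (cell_after e \in F).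

Record alternating_shape (n : nat) := AlternatingShape {
  shape_cells :> {fset (int * int)};
  start_steps : n.-tuple direction;
  end_steps : n.-tuple direction;
  nw_length : nat;
  se_length : nat;
  shape_connected : connected_cells shape_cells;
  start_steps_SE : forall i : 'I_n,
    tnth start_steps i = South \/ tnth start_steps i = East;
  end_steps_SE : forall i : 'I_n,
    tnth end_steps i = South \/ tnth end_steps i = East;
  shape_closed :
    path_end (path_end (0, 0) start_steps) (stair East North se_length)
    = path_end (nw_length%:Z, nw_length%:Z) end_steps;
  (* The i-th vertices of the starting and ending paths lie on the same
     diagonal x - y = i, so it suffices to compare these.  The extreme vertices
     are excluded because the two paths share their first (resp. last) vertex
     when the NW (resp. SE) stair path is empty. *)
  end_NE_of_start : forall i : nat, (0 < i < n)%N ->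
    let u := path_vertex (0, 0) start_steps i in
    let v := path_vertex (nw_length%:Z, nw_length%:Z) end_steps i in
    (u.1 < v.1) && (u.2 < v.2);
  shape_boundary : forall e : edge,
    boundary_edge shape_cells e =
    (e \in path_edges (0, 0) start_steps
        ++ path_edges (0, 0) (stair North East nw_length)
        ++ path_edges (nw_length%:Z, nw_length%:Z) end_steps
        ++ path_edges (path_end (0, 0) start_steps)
             (stair East North se_length))
}.

Definition start_edge n (F : alternating_shape n) (i : 'I_n) : edge :=
  path_edge (0, 0) (start_steps F) i.

Definition end_edge n (F : alternating_shape n) (i : 'I_n) : edge :=
  path_edge ((nw_length F)%:Z, (nw_length F)%:Z) (end_steps F) i.

Variant tile := Cross | Contact.

(* A filling of a shape is given as a function on all cells; its values outside
   the shape are never used. *)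
Definition filling : Type := cell -> tile.

(* The side through which a pipe that enters [cell_after e] through [e] leaves
   that cell. *)
Definition exit_side (P : filling) (e : edge) : edge :=
  let c := cell_after e in
  match P c, e.1 with
  | Cross, true => east_side c
  | Cross, false => north_side c
  | Contact, true => north_side c
  | Contact, false => east_side c
  end.

(* [passes F P i e]: pipe [i] goes through the edge [e].  Pipes (and steps) are
   numbered from 0. *)
Inductive passes n (F : alternating_shape n) (P : filling) (i : 'I_n) :
    edge -> Prop :=
| passes_start : passes F P i (start_edge F i)
| passes_next e : passes F P i e -> cell_after e \in shape_cells F ->
    passes F P i (exit_side P e).

(* The elbows of contacts along the NW and SE stair paths which join two edges
   of these stair paths carry no pipe. *)
Definition pipe_dream n (F : alternating_shape n) (P : filling) : Prop :=
  forall i : 'I_n, exists j : 'I_n, passes F P i (end_edge F j).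

Definition exit_permutation n (F : alternating_shape n) (P : filling)
    (w : 'S_n) : Prop :=
  forall i : 'I_n, passes F P (w i) (end_edge F i).

Definition crosses_at n (F : alternating_shape n) (P : filling) (i j : 'I_n)
    (c : cell) : Prop :=
  [/\ c \in shape_cells F, P c = Cross &
      (passes F P i (west_side c) /\ passes F P j (south_side c)) \/
      (passes F P j (west_side c) /\ passes F P i (south_side c))].

Definition reduced n (F : alternating_shape n) (P : filling) : Prop :=
  forall (i j : 'I_n) (c c' : cell), i != j ->
    crosses_at F P i j c -> crosses_at F P i j c' -> c = c'.

Definition sortable n (F : alternating_shape n) (w : 'S_n) : Prop :=
  exists P : filling,
    [/\ pipe_dream F P, reduced F P & exit_permutation F P w].

Definition longest_perm n : 'S_n := perm (@rev_ord_inj n).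

Definition complete n (F : alternating_shape n) : Prop :=
  sortable F (longest_perm n).

Definition noninversion n (w : 'S_n) (a b : 'I_n) : Prop :=
  (a < b)%N /\ ((w^-1)%g a < (w^-1)%g b)%N.

(* The NW elbow of a contact starts on the west side of the cell and its SE
   elbow starts on the south side. *)
Definition contact_arc n (F : alternating_shape n) (P : filling)
    (a b : 'I_n) : Prop :=
  exists c : cell,
    [/\ c \in shape_cells F, P c = Contact,
        passes F P a (west_side c) & passes F P b (south_side c)].

Definition contact_path n (F : alternating_shape n) (P : filling) :
    'I_n -> 'I_n -> Prop :=
  clos_trans 'I_n (contact_arc F P).

(* Main.v *)
Require Import Defs.
From mathcomp Require Import all_boot all_order all_algebra all_fingroup.
From mathcomp Require Import finmap zify.
From Stdlib Require Import Relation_Operators ClassicalEpsilon.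

Set Implicit Arguments.
Unset Strict Implicit.
Unset Printing Implicit Defensive.

Import Order.TTheory GRing.Theory Num.Theory.

Local Open Scope ring_scope.

(* Sweep the shape by lattice paths from the starting path to the ending path,
   adding one cell at a time; position [p] of such a path is crossed by one
   pipe.  A cell on the diagonal x - y = l acts on the positions [l-1] and [l]
   like a letter of a sorting network, and the cells with l = 0 or l = n are
   walls.

   Besides the pipes, carry the labels of the greedy sorting of [id], where two
   lines cross as soon as they meet in increasing order.  Completeness means
   that this sorts to the longest permutation.

   Let A be the set of pipes reachable from p, and B its complement: a contact
   between A and B has the B pipe on its NW elbow.  Compare, along the sweep,
   the number u of pairs of positions i < j holding pipes a < b with a in A and
   b in B, to the number Phi of pairs of positions i < j holding an A pipe and a
   B pipe whose labels are increasing.  Both start equal.  At a cell entered by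
   A from the west and B from the south the two pipes must cross and u drops
   by 1; otherwise u is constant, as P is reduced.  A case analysis shows that
   Phi never drops more than u.  The only delicate cell is one where B and A
   cross while their two labels are already decreasing; there Phi is preserved
   because in an alternating shape these two labels are consecutive.  As Phi
   ends at 0, so does u: no pair (a, b) in A x B is a noninversion. *)

(** * Fronts and the boundary of the shape *)

(* A lattice path of south and east steps, given by the abscissas of its
   vertices: its l-th vertex lies on the diagonal x - y = l. *)
Definition front : Type := nat -> int.

Definition vertex (X : front) (l : nat) : point := (X l, X l - l%:Z).

Definition front_edge (X : front) (p : nat) : edge :=
  if X p.+1 == X p then (true, (X p, X p - p.+1%:Z))
  else (false, (X p, X p - p%:Z)).

(* Position, counted from 1, of an edge in the fronts which contain it. *)
Definition edge_index (e : edge) : int :=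
  if e.1 then e.2.1 - e.2.2 else e.2.1 - e.2.2 + 1.

Lemma edge_index_front X p : edge_index (front_edge X p) = p.+1%:Z.
Proof. by rewrite /front_edge /edge_index; case: eqP => _ /=; lia. Qed.

(** An edge determines the cell it leaves, and either tile matches entry sides with exit sides
    bijectively; so pipes can be traced backwards. *)
Lemma exit_side_inj P : injective (exit_side P).
Proof.
move=> [b [x y]] [b' [x' y']]; rewrite /exit_side /cell_after /=.
case E: (P (x, y)); case: b; case E': (P (x', y')); case: b' => //= [] [] H1 H2;
  (have ex : x = x' by lia); (have ey : y = y' by lia);
  subst; congruence.
Qed.

Lemma cell_before_exit_side P e : cell_before (exit_side P e) = cell_after e.
Proof.
case: e => b [x y]; rewrite /exit_side /cell_after /cell_before.
by case: (P _); case: b => /=; congr (_, _); lia.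
Qed.

Lemma path_edges_cons p d w :
  path_edges p (d :: w) = step_edge p d :: path_edges (move p d) w.
Proof.
rewrite /path_edges /= /path_edge /= /path_vertex take0 /=; congr (_ :: _).
rewrite (iotaDl 1 0) -map_comp; apply: eq_map => i /=.
by rewrite /path_edge /path_vertex.
Qed.

(** The abscissa bound lets a westward walk on diagonal 0, left of the origin, miss the NW stair. *)
Lemma stair_NE_edges p k e : e \in path_edges p (stair North East k) ->
  edge_index e = p.1 - p.2 /\ p.1 <= e.2.1.
Proof.
elim: k p => [|k IH] p //=; rewrite /stair /= -/(stair _ _ _).
rewrite !path_edges_cons !inE => /or3P[/eqP->|/eqP->|/IH] /=.
- by rewrite /edge_index /=; lia.
- by rewrite /edge_index /=; lia.
- by case=> -> /= ?; lia.
Qed.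

Lemma stair_EN_edges p k e : e \in path_edges p (stair East North k) ->
  edge_index e = p.1 - p.2 + 1.
Proof.
elim: k p => [|k IH] p //=; rewrite /stair /= -/(stair _ _ _).
rewrite !path_edges_cons !inE => /or3P[/eqP->|/eqP->|/IH] /=.
- by rewrite /edge_index /=; lia.
- by rewrite /edge_index /=; lia.
- by move=> ->; lia.
Qed.

Lemma stair_EN_end p k : path_end p (stair East North k) = (p.1 + k%:Z, p.2 + k%:Z).
Proof.
elim: k p => [|k IH] p; first by case: p => x y /=; congr (_, _); lia.
by rewrite /stair /= -/(stair _ _ _) -/(path_end _ _) IH /=; congr (_, _); lia.
Qed.

Lemma path_vertexS p w i : (i < size w)%N ->
  path_vertex p w i.+1 = move (path_vertex p w i) (nth South w i).
Proof.
by move=> lt; rewrite /path_vertex (take_nth South lt) /path_end -cats1 foldl_cat.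
Qed.

Section Shape.

Variables (n : nat) (F : alternating_shape n).

Definition start_front : front := fun l => (path_vertex (0, 0) (start_steps F) l).1.
Definition end_front : front :=
  fun l => (path_vertex ((nw_length F)%:Z, (nw_length F)%:Z) (end_steps F) l).1.

Lemma SE_path_vertex (p : point) (w : n.-tuple direction) l :
  (forall i : 'I_n, tnth w i = South \/ tnth w i = East) -> (l <= n)%N ->
  (path_vertex p w l).2 = (path_vertex p w l).1 - l%:Z - (p.1 - p.2).
Proof.
move=> H; elim: l => [|l IH] lt; first by rewrite /path_vertex take0 /=; lia.
rewrite path_vertexS ?size_tuple //.
by have := H (Ordinal lt); rewrite (tnth_nth South) /= => -[] -> /=;
  rewrite IH; lia.
Qed.

Lemma SE_path_step (p : point) (w : n.-tuple direction) l :
  (forall i : 'I_n, tnth w i = South \/ tnth w i = East) -> (l < n)%N ->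
  (path_vertex p w l.+1).1 = (path_vertex p w l).1 \/
  (path_vertex p w l.+1).1 = (path_vertex p w l).1 + 1.
Proof.
move=> H lt; rewrite path_vertexS ?size_tuple //.
by have := H (Ordinal lt); rewrite (tnth_nth South) /= => -[] -> /=; auto.
Qed.

Lemma SE_path_edge (p : point) (w : n.-tuple direction) l :
  (forall i : 'I_n, tnth w i = South \/ tnth w i = East) -> (l < n)%N ->
  p.1 = p.2 ->
  path_edge p w l = front_edge (fun l => (path_vertex p w l).1) l.
Proof.
move=> H lt ep; rewrite /path_edge /front_edge path_vertexS ?size_tuple //.
have := SE_path_vertex p H (ltnW lt); rewrite ep subrr subr0.
case: (path_vertex p w l) => x y /= ->.
have := H (Ordinal lt); rewrite (tnth_nth South) /= => -[] -> /=.
  by rewrite eqxx; congr (_, (_, _)); lia.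
by case: eqP => //; lia.
Qed.

Lemma start_edgeE (i : 'I_n) : start_edge F i = front_edge start_front i.
Proof. by apply: SE_path_edge => //; apply: start_steps_SE. Qed.

Lemma end_edgeE (i : 'I_n) : end_edge F i = front_edge end_front i.
Proof. by apply: SE_path_edge => //; apply: end_steps_SE. Qed.

Lemma start_step p : (p < n)%N ->
  start_front p.+1 = start_front p \/ start_front p.+1 = start_front p + 1.
Proof. by apply: SE_path_step; apply: start_steps_SE. Qed.

Lemma end_step p : (p < n)%N ->
  end_front p.+1 = end_front p \/ end_front p.+1 = end_front p + 1.
Proof. by apply: SE_path_step; apply: end_steps_SE. Qed.

Lemma start_front0 : start_front 0 = 0.
Proof. by rewrite /start_front /path_vertex take0. Qed.

Lemma start_front_mono k l : (k <= l <= n)%N ->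
  start_front k <= start_front l <= start_front k + (l - k)%N%:Z.
Proof.
elim: l => [|l IH] /andP[kl ln].
  have -> : k = 0%N by lia.
  by rewrite subnn addr0 lexx.
have [->|ne] := k =P l.+1; first by rewrite subnn addr0 lexx.
have := IH _; have := start_step ln; lia.
Qed.

Lemma start_le_end l : (l <= n)%N -> start_front l <= end_front l.
Proof.
move=> ln; have [l0|l0] := posnP l.
  rewrite l0 start_front0 /end_front /path_vertex take0 /=; lia.
have [ltn|] := ltnP l n.
  have /(@end_NE_of_start n F) /andP[] : (0 < l < n)%N by lia.
  by move=> lt _; exact: ltW.
move=> nl; have -> : l = n by lia.
have := shape_closed F; rewrite stair_EN_end.
rewrite /start_front /end_front /path_vertex !take_oversize ?size_tuple // => <- /=.
lia.
Qed.

Lemma start_end_lt l : (0 < l < n)%N -> start_front l < end_front l.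
Proof. by move/(@end_NE_of_start n F)/andP => []. Qed.

Lemma start_neq_end p : (1 < n)%N -> (p < n)%N ->
  front_edge start_front p <> front_edge end_front p.
Proof.
move=> n1 pn; rewrite /front_edge => eq_edge.
have [eS eE] : start_front p = end_front p /\ start_front p.+1 = end_front p.+1.
  have := start_step pn; have := end_step pn; move: eq_edge.
  by case: eqP => ?; case: eqP => ? [] //; lia.
have [p0|p0] := posnP p.
  by have /start_end_lt : (0 < p.+1 < n)%N by [lia]; rewrite eE ltxx.
by have /start_end_lt : (0 < p < n)%N by [lia]; rewrite eS ltxx.
Qed.

(** The index separates the paths: 0 on the NW stair, [n + 1] on the SE stair, 1 to [n] on the
    starting and ending paths. *)
Lemma boundary_edgeP e : boundary_edge F e ->
  [\/ exists2 p, (p < n)%N & e = front_edge start_front p,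
      exists2 p, (p < n)%N & e = front_edge end_front p,
      edge_index e = 0 /\ 0 <= e.2.1
    | edge_index e = n.+1%:Z].
Proof.
rewrite shape_boundary !mem_cat => /or4P[/mapP[p]|H|/mapP[p]|H].
- rewrite mem_iota size_tuple /= add0n => pn ->; apply: Or41; exists p => //.
  exact: (start_edgeE (Ordinal pn)).
- by apply: Or43; have := stair_NE_edges H; rewrite subrr.
- rewrite mem_iota size_tuple /= add0n => pn ->; apply: Or42; exists p => //.
  exact: (end_edgeE (Ordinal pn)).
- apply: Or44; rewrite (stair_EN_edges H).
  have := SE_path_vertex (0, 0) (@start_steps_SE n F) (leqnn n).
  rewrite /path_vertex take_oversize ?size_tuple //= => ->; lia.
Qed.

(** * Cells outside the shape *)

Lemma shape_bounded :
  exists b : int, forall c : cell, c \in shape_cells F -> - b <= c.1 <= b.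
Proof.
have [b Hb] : exists b : int,
    forall c : cell, c \in enum_fset (shape_cells F) -> - b <= c.1 <= b.
  elim: (enum_fset _) => [|c0 s [b Hb]]; first by exists 0.
  exists (`|c0.1| + `|b|) => c; rewrite inE.
  by move=> /orP[/eqP->|/Hb]; move: (c.1) (c0.1) => x y; lia.
by exists b.
Qed.

Lemma boundary_false_west (c : cell) : ~~ boundary_edge F (west_side c) ->
  c \in shape_cells F -> (c.1 - 1, c.2) \in shape_cells F.
Proof. by case: c => x y; rewrite /boundary_edge /= negbK => /eqP ->. Qed.

Lemma boundary_false_east (c : cell) : ~~ boundary_edge F (east_side c) ->
  c \in shape_cells F -> (c.1 + 1, c.2) \in shape_cells F.
Proof.
case: c => x y; rewrite /boundary_edge /cell_before /cell_after /= negbK.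
by rewrite addrK => /eqP ->.
Qed.

(* From such a cell one can walk west for ever without meeting the boundary. *)
Definition left_of_start (c : cell) : Prop :=
  c.1 - c.2 < 0 \/ exists l, [/\ (l <= n)%N, c.1 - c.2 = l%:Z & c.1 < start_front l].

Lemma left_of_start_notin c : left_of_start c -> c \notin shape_cells F.
Proof.
move=> out; apply/negP => cF; have [b Hb] := shape_bounded.
suff walk k : (c.1 - k%:Z, c.2) \in shape_cells F /\ left_of_start (c.1 - k%:Z, c.2).
  have [/Hb /= + _] := walk (absz (c.1 + b + 1)%R); have := Hb _ cF; lia.
elim: k => [|k [IHF IHo]]; first by rewrite subr0; case: c out cF.
have -> : c.1 - k.+1%:Z = c.1 - k%:Z - 1 by lia.
move: (c.1 - k%:Z) IHF IHo => x; move: c.2 => y {b Hb c cF out k} xF out.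
have oute : ~~ boundary_edge F (west_side (x, y)).
  apply/negP => /boundary_edgeP[] [].
  - move=> p pn; have := start_step pn; have := start_front_mono (k := p) (l := p.+1).
    rewrite /front_edge; case: eqP => // e1 + _ [] ? ?.
    case: out => /= [|[l [ln xyl xl]]]; first by lia.
    by have el : l = p.+1 by [lia]; subst l; lia.
  - move=> p pn; have := end_step pn.
    rewrite /front_edge; case: eqP => // e1 _ [] ? ?.
    case: out => /= [|[l [ln xyl xl]]]; first by lia.
    have el : l = p.+1 by [lia]; subst l; have := start_le_end ln; lia.
  - rewrite /edge_index /= => ? ?.
    case: out => /= [|[l [ln xyl xl]]]; first by lia.
    have el : l = 0%N by [lia]; subst l; move: xl; rewrite start_front0; lia.
  - rewrite /edge_index /= => ?.
    by case: out => /= [|[l [ln xyl xl]]]; lia.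
split; first exact: (boundary_false_west oute).
case: out => /= [|[[|l] [ln xyl xl]]]; [by left => /=; lia|by left => /=; lia|].
right; exists l; split => /=; [lia|lia|].
by have := start_step ln; lia.
Qed.

(** Walking east from such a cell crosses only edges of index at least [n + 2], never the boundary,
    which contradicts finiteness. *)
Lemma right_of_SE_notin (c : cell) : n%:Z < c.1 - c.2 -> c \notin shape_cells F.
Proof.
move=> out; apply/negP => cF; have [b Hb] := shape_bounded.
suff walk k : (c.1 + k%:Z, c.2) \in shape_cells F.
  have /Hb /= := walk (absz (b - c.1 + 1)%R); have := Hb _ cF; lia.
elim: k => [|k IHF]; first by rewrite addr0; case: c out cF.
have -> : c.1 + k.+1%:Z = c.1 + k%:Z + 1 by lia.
apply: (boundary_false_east (c := (c.1 + k%:Z, c.2))) => //.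
apply/negP => /boundary_edgeP[] [].
- by move=> p pn /(congr1 edge_index); rewrite edge_index_front /edge_index /=; lia.
- by move=> p pn /(congr1 edge_index); rewrite edge_index_front /edge_index /=; lia.
- by rewrite /edge_index /=; lia.
- by rewrite /edge_index /=; lia.
Qed.

End Shape.

(** * Sweeping the shape *)

Definition advance (X : front) (l : nat) : front :=
  fun m => if m == l then X l + 1 else X m.

Lemma advance_at X l : advance X l l = X l + 1.
Proof. by rewrite /advance eqxx. Qed.

Lemma advance_off X l m : m != l -> advance X l m = X m.
Proof. by rewrite /advance => /negPf ->. Qed.

Section Sweep.

Variables (n : nat) (F : alternating_shape n).

(** The vertex is the SW corner of a cell that may be added next. At the walls only one entry side
    lies on the front, whence the guards. *)
Definition corner (X : front) (l : nat) : Prop :=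
  [/\ (l <= n)%N, X l < end_front F l, (0 < l)%N -> X l.-1 = X l
    & (l < n)%N -> X l.+1 = X l + 1].

(** Membership in the shape is recorded only for the cells along the front; this is enough to find
    the next cell. *)
Definition swept (X : front) : Prop :=
  [/\ forall p, (p < n)%N -> X p.+1 = X p \/ X p.+1 = X p + 1,
      forall l, (l <= n)%N -> start_front F l <= X l <= end_front F l,
      forall p, (p < n)%N -> front_edge X p <> front_edge (end_front F) p ->
        cell_after (front_edge X p) \in shape_cells F
    & forall p, (p < n)%N -> front_edge X p <> front_edge (start_front F) p ->
        cell_before (front_edge X p) \in shape_cells F].

Lemma corner_west X l : corner X l -> (0 < l)%N ->
  front_edge X l.-1 = west_side (vertex X l).
Proof.
case: l => // l [_ _ /(_ isT) /= e _] _; rewrite /front_edge e eqxx.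
by rewrite /west_side /vertex; congr (_, (_, _)); lia.
Qed.

Lemma corner_south X l : corner X l -> (l < n)%N ->
  front_edge X l = south_side (vertex X l).
Proof.
by case=> [_ _ _ e] /e e'; rewrite /front_edge e' ifF //; apply/eqP; lia.
Qed.

Lemma corner_north X l : corner X l -> (0 < l)%N ->
  front_edge (advance X l) l.-1 = north_side (vertex X l).
Proof.
case: l => // l [_ _ /(_ isT) /= e _] _; rewrite /front_edge.
rewrite advance_at advance_off ?neq_ltn ?ltnSn // e ifF; last by apply/eqP; lia.
by rewrite /north_side /vertex /=; congr (_, (_, _)); lia.
Qed.

Lemma corner_east X l : corner X l -> (l < n)%N ->
  front_edge (advance X l) l = east_side (vertex X l).
Proof.
case=> [_ _ _ e] /e e'; rewrite /front_edge.
rewrite advance_at advance_off ?neq_ltn ?ltnSn ?orbT // e' eqxx.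
by rewrite /east_side /vertex /=; congr (_, (_, _)); lia.
Qed.

Lemma front_edge_advance X l p : p.+1 != l -> p != l ->
  front_edge (advance X l) p = front_edge X p.
Proof. by move=> ne ne'; rewrite /front_edge !advance_off. Qed.

Lemma eq_front_edge X Y p : X p = Y p -> X p.+1 = Y p.+1 ->
  front_edge X p = front_edge Y p.
Proof. by rewrite /front_edge => -> ->. Qed.

Lemma start_edge_before (i : 'I_n) : cell_before (start_edge F i) \notin shape_cells F.
Proof.
apply: left_of_start_notin; right; rewrite start_edgeE.
have := start_step F (ltn_ord i); rewrite /front_edge.
have := ltn_ord i; case: eqP => e H H1.
  exists i; rewrite /cell_before /=; split; [lia|lia|lia].
exists i.+1; rewrite /cell_before /=; split; [lia|lia|lia].
Qed.

Lemma swept_start : (1 < n)%N -> swept (start_front F).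
Proof.
move=> n1; split => // [p pn|l ln|p pn _].
- exact: start_step.
- by rewrite lexx start_le_end.
have bd : boundary_edge F (front_edge (start_front F) p).
  rewrite shape_boundary mem_cat; apply/orP; left.
  rewrite -(start_edgeE F (Ordinal pn)); apply/mapP; exists p => //.
  by rewrite mem_iota size_tuple.
have := start_edge_before (Ordinal pn); rewrite start_edgeE.
by move: bd; rewrite /boundary_edge; case: (cell_before _ \in _); case: (_ \in _).
Qed.

Lemma corner_cell X l : (1 < n)%N -> swept X -> corner X l ->
  vertex X l \in shape_cells F.
Proof.
move=> n1 [step _ after _] c; have [ln lt pe ne] := c.
have [l0|l0] := posnP l.
  have ltn : (l < n)%N by lia.
  have := after _ ltn; rewrite (corner_south c ltn); apply.
  rewrite -(corner_south c ltn) => eq_edge.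
  have := step _ ltn; have := end_step F ltn; move: eq_edge; rewrite /front_edge.
  by case: eqP => ?; case: eqP => ? [] //; lia.
have ltn : (l.-1 < n)%N by lia.
have := after _ ltn; rewrite (corner_west c l0); apply.
rewrite -(corner_west c l0) => eq_edge.
have := step _ ltn; have := end_step F ltn; move: eq_edge; rewrite /front_edge prednK //.
by have := pe l0; case: eqP => ?; case: eqP => ? ? [] //; lia.
Qed.

Lemma swept_advance X l : (1 < n)%N -> swept X -> corner X l -> swept (advance X l).
Proof.
move=> n1 sw c; have cF := corner_cell n1 sw c.
have [step bound after before] := sw; have [ln lt pe ne] := c.
have newcell p : (p < n)%N -> p.+1 = l \/ p = l ->
    cell_before (front_edge (advance X l) p) = vertex X l.
  move=> pn [e|e].
    subst l; rewrite (corner_north c) // /cell_before /=.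
    by rewrite /vertex; congr (_, _); lia.
  subst l; rewrite (corner_east c) // /cell_before /=.
  by rewrite /vertex; congr (_, _); lia.
have touched p : (p.+1 = l \/ p = l) \/ (p.+1 != l /\ p != l).
  by have [->|?] := eqVneq p.+1 l; [auto|]; have [->|?] := eqVneq p l; auto.
split.
- move=> p pn; rewrite /advance.
  have [e|ne1] := eqVneq p.+1 l.
    by subst l; rewrite ifF; [have := pe isT => /=; lia|apply/eqP; lia].
  have [e|ne2] := eqVneq p l; last exact: step.
  by subst l; have := ne pn; lia.
- move=> m mn; have := bound _ mn; have [->|ne1] := eqVneq m l.
    by rewrite advance_at; lia.
  by rewrite advance_off.
- move=> p pn neq; have [t|[t1 t2]] := touched p; last first.
    by move: neq; rewrite front_edge_advance //; apply: after.
  (* The new vertex is strictly east of the starting front, the edge is not an ending edge by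
     assumption, and its index is between 1 and [n]. *)
  have nb : ~~ boundary_edge F (front_edge (advance X l) p).
    apply/negP => /boundary_edgeP[] [].
    + move=> p' pn' eq_edge.
      have := congr1 edge_index eq_edge; rewrite !edge_index_front => epp.
      have {epp} epp : p' = p by lia.
      subst p'; move: eq_edge; have := start_step F pn; have := bound _ ln.
      rewrite /front_edge; case: t => e; subst l.
        rewrite advance_at advance_off ?neq_ltn ?ltnSn //.
        have := pe isT => /=; have := bound _ (ltnW pn).
        by case: eqP => ?; case: eqP => ? ? ? ? ? [] //; lia.
      rewrite advance_at advance_off ?neq_ltn ?ltnSn ?orbT //.
      by have := ne pn; case: eqP => ?; case: eqP => ? ? ? ? [] //; lia.
    + move=> p' pn' eq_edge.
      have := congr1 edge_index eq_edge; rewrite !edge_index_front => epp.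
      by have {epp} epp : p' = p by [lia]; subst p'.
    + by rewrite edge_index_front.
    + by rewrite edge_index_front; lia.
  move: nb; rewrite /boundary_edge newcell // cF.
  by case: (_ \in _).
- move=> p pn neq; have [t|[t1 t2]] := touched p; first by rewrite newcell.
  by move: neq; rewrite front_edge_advance //; apply: before.
Qed.

(* An unfinished vertex whose antidiagonal [x + y] is least is a corner. *)
Lemma corner_exists X : swept X -> (exists2 l, (l <= n)%N & X l != end_front F l) ->
  exists l, corner X l.
Proof.
move=> [step bound _ _] [l0 ln0 ne0].
pose unfin := fun l : 'I_n.+1 => X l != end_front F l.
have u0 : unfin (inord l0) by rewrite /unfin inordK.
case: (@arg_minP _ _ _ (inord l0) unfin (fun l : 'I_n.+1 => X l + X l - l%:Z) u0).
move=> l ul minl; have ln : (l <= n)%N by rewrite -ltnS.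
have finished m : (m <= n)%N -> X m + X m - m%:Z < X l + X l - l%:Z ->
    X m = end_front F m.
  move=> mn lt; apply/eqP; apply: contraLR lt => um.
  have := minl (inord m); rewrite /unfin inordK // => /(_ um); lia.
have := bound _ ln; move: ul; rewrite /unfin => ul bl.
exists l; split => //; first by lia.
- move=> l0'; have pn : (l.-1 < n)%N by lia.
  have := step _ pn; rewrite prednK // => -[//|e].
  have := finished l.-1 (ltnW pn); have := end_step F pn; rewrite prednK //; lia.
- move=> pn; have := step _ pn => -[e|//].
  have := finished l.+1 pn; have := end_step F pn; lia.
Qed.

Lemma sweep (J : front -> Prop) : (1 < n)%N -> J (start_front F) ->
  (forall X l, swept X -> corner X l -> J X -> J (advance X l)) ->
  exists X, [/\ swept X, forall l, (l <= n)%N -> X l = end_front F l & J X].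
Proof.
move=> n1 J0 Jstep.
pose todo (X : front) := (\sum_(l < n.+1) absz (end_front F l - X l))%N.
suff main N X : (todo X <= N)%N -> swept X -> J X ->
    exists X, [/\ swept X, forall l, (l <= n)%N -> X l = end_front F l & J X].
  exact: main (leqnn _) (swept_start n1) J0.
elim: N X => [|N IH] X le sw JX; have [fin|unf] :=
    classic (forall l, (l <= n)%N -> X l = end_front F l); try by exists X.
  case: unf => l ln; move: le; rewrite leqn0 sum_nat_eq0.
  move/forallP/(_ (Ordinal (ln : (l < n.+1)%N))) => /=; lia.
have [l c] : exists l, corner X l.
  apply: corner_exists => //; apply: NNPP => H; apply: unf => l ln.
  by apply/eqP; apply: contraT => ne; case: H; exists l.
apply: (IH (advance X l)) => //; [|exact: swept_advance|exact: Jstep].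
have [ln lt _ _] := c; rewrite -ltnS; apply: leq_trans le.
rewrite /todo (bigD1 (Ordinal (ln : (l < n.+1)%N))) //=.
rewrite [X in (_ < X)%N](bigD1 (Ordinal (ln : (l < n.+1)%N))) //=.
rewrite advance_at [X in (_ + X)%N](eq_bigr (fun i : 'I_n.+1 => absz (end_front F i - X i))).
  by rewrite ltn_add2r; lia.
by move=> i; rewrite -val_eqE /= => ne; rewrite advance_off.
Qed.

(** A sweep with trivial invariant shows that the cell before the edge is in the shape; as the edge
    is on the boundary, the cell after it is not. *)
Lemma end_edge_after (i : 'I_n) : (1 < n)%N ->
  cell_after (end_edge F i) \notin shape_cells F.
Proof.
move=> n1.
have [X [[_ _ _ before] fin _]] := @sweep (fun=> True) n1 I (fun _ _ _ _ _ => I).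
have e : front_edge X i = front_edge (end_front F) i.
  by apply: eq_front_edge; apply: fin; [exact: ltnW|].
have bF : cell_before (end_edge F i) \in shape_cells F.
  rewrite end_edgeE -e; apply: before => //; rewrite e => /esym.
  exact: start_neq_end.
have bd : boundary_edge F (end_edge F i).
  rewrite shape_boundary !mem_cat; apply/orP; right; apply/orP; right.
  apply/orP; left; apply/mapP; exists (i : nat) => //.
  by rewrite mem_iota size_tuple /= add0n ltn_ord.
by move: bd; rewrite /boundary_edge bF; case: (_ \in _).
Qed.

End Sweep.

(** * Pipes along a front *)

Section Pipes.

Variables (n : nat) (F : alternating_shape n) (P : filling).

Lemma start_edge_inj : injective (start_edge F).
Proof.
move=> i j; rewrite !start_edgeE => /(congr1 edge_index).
by rewrite !edge_index_front => e; apply/val_inj => /=; lia.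
Qed.

Lemma start_edge_not_exit (i : 'I_n) e :
  cell_after e \in shape_cells F -> start_edge F i <> exit_side P e.
Proof.
move=> eF E; have := start_edge_before F i.
by rewrite E cell_before_exit_side eF.
Qed.

(** Follow both pipes backwards; an entry step has no predecessor, since the cell before it is
    outside the shape. *)
Lemma passes_uniq i j e : passes F P i e -> passes F P j e -> i = j.
Proof.
move=> pi; elim: pi j => [|e' _ IH e'F] j.
  case E : _ / => [|e' _ e'F]; first exact: start_edge_inj.
  by case: (start_edge_not_exit e'F E).
case E : _ / => [|e2 p2 e2F]; first by case: (start_edge_not_exit e'F (esym E)).
by move/exit_side_inj: E p2 => <- /IH.
Qed.

Lemma passes_iter i e : passes F P i e ->
  exists m, e = iter m (exit_side P) (start_edge F i) /\
    forall k, (k < m)%N ->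
      cell_after (iter k (exit_side P) (start_edge F i)) \in shape_cells F.
Proof.
elim=> [|e' _ [m [-> H]] e'F]; first by exists 0%N.
exists m.+1; split => // k; rewrite ltnS leq_eqVlt => /predU1P[->//|]; exact: H.
Qed.

Lemma passes_exit_uniq i e e' : passes F P i e -> passes F P i e' ->
  cell_after e \notin shape_cells F -> cell_after e' \notin shape_cells F -> e = e'.
Proof.
move=> /passes_iter[m [-> H]] /passes_iter[m' [-> H']] out out'.
case: (ltngtP m m') => [/H'|/H|->//].
- by rewrite (negPf out).
- by rewrite (negPf out').
Qed.

Hypothesis n1 : (1 < n)%N.

Lemma passes_into_shape i e : pipe_dream F P -> passes F P i e ->
  cell_after e \in shape_cells F ->
  (0 < edge_index (exit_side P e) <= n%:Z) \/
  cell_after (exit_side P e) \in shape_cells F.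
Proof.
move=> dream pe eF; have [?|out] := boolP (cell_after (exit_side P e) \in shape_cells F); [by right|left].
have [j pj] := dream i.
have -> := passes_exit_uniq (passes_next pe eF) pj out (end_edge_after F j n1).
by rewrite end_edgeE edge_index_front; have := ltn_ord j; lia.
Qed.

Definition is_cross (t : tile) : bool := if t is Cross then true else false.

Definition swap_at (T : Type) (l : nat) (f : nat -> T) : nat -> T :=
  fun p => if p == l.-1 then f l else if p == l then f l.-1 else f p.

Definition next_pipes (X : front) (l : nat) (f : nat -> 'I_n) : nat -> 'I_n :=
  if (0 < l < n)%N && is_cross (P (vertex X l)) then swap_at l f else f.

Definition carries (X : front) (f : nat -> 'I_n) : Prop :=
  forall p, (p < n)%N -> passes F P (f p) (front_edge X p).

(** A cross would send the pipe out of the shape through an edge of index 0 or [n + 1], but pipes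
    leave only at indices 1 to [n]. *)
Lemma wall_contact X l f : pipe_dream F P -> swept F X -> corner F X l ->
  carries X f -> ~~ (0 < l < n)%N -> P (vertex X l) = Contact.
Proof.
move=> dream sw c cr wall; have cF := corner_cell n1 sw c; have [ln _ _ _] := c.
case E: (P _) => //; exfalso.
have [l0|l0] := posnP l.
  have ltn : (l < n)%N by lia.
  have := cr _ ltn; rewrite (corner_south c ltn) => /passes_into_shape - /(_ dream cF).
  rewrite /exit_side /cell_after /= E l0 => -[|/=].
    by rewrite /edge_index /=; lia.
  by apply/negP; apply: left_of_start_notin; left => /=; lia.
have ltn : (l.-1 < n)%N by lia.
have := cr _ ltn; rewrite (corner_west c l0) => /passes_into_shape - /(_ dream cF).
rewrite /exit_side /cell_after /= E => -[|/=].
  by rewrite /edge_index /=; lia.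
by apply/negP; apply: right_of_SE_notin => /=; lia.
Qed.

Lemma carries_advance X l f : pipe_dream F P -> swept F X -> corner F X l ->
  carries X f -> carries (advance X l) (next_pipes X l f).
Proof.
move=> dream sw c cr; have cF := corner_cell n1 sw c; have [ln _ _ _] := c.
move=> p pn; have [e|ne1] := eqVneq p.+1 l.
  subst l; rewrite (corner_north c) //.
  rewrite /next_pipes /=; have [ltn|nlt] := ltnP p.+1 n.
    have := cr _ pn; have := cr _ ltn; rewrite (corner_south c ltn).
    rewrite (corner_west c) // => /passes_next - /(_ cF).
    move=> + /passes_next - /(_ cF); rewrite /exit_side /cell_after /=.
    by case: (P _); rewrite //= /swap_at eqxx.
  have w : ~~ (0 < p.+1 < n)%N by lia.
  have := cr _ pn; rewrite (corner_west c) // => /passes_next - /(_ cF).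
  by rewrite /exit_side /cell_after /= (wall_contact dream sw c cr w).
have [e|ne2] := eqVneq p l.
  subst l; rewrite (corner_east c) //.
  rewrite /next_pipes pn andbT; have [p0|p0] := posnP p.
    have w : ~~ (0 < p < n)%N by lia.
    have := cr _ pn; rewrite (corner_south c) // => /passes_next - /(_ cF).
    by rewrite /exit_side /cell_after /= (wall_contact dream sw c cr w).
  have pn' : (p.-1 < n)%N by lia.
  have := cr _ pn; have := cr _ pn'; rewrite (corner_south c) //.
  rewrite (corner_west c) // => /passes_next - /(_ cF).
  move=> + /passes_next - /(_ cF); rewrite /exit_side /cell_after /=.
  by case: (P _) => //=; rewrite /swap_at eqxx ifF //; lia.
rewrite front_edge_advance // (_ : next_pipes X l f p = f p); first exact: cr.
rewrite /next_pipes /swap_at; case: ifP => // /andP[/andP[l0 _] _].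
by rewrite (negPf ne2) ifF //; lia.
Qed.

End Pipes.

(** * Greedy sorting *)

Section Sorting.

Variables (n : nat) (F : alternating_shape n).

(* Closed form for "the greedy sorting has a label at least [k] on the edge [e]".
   Replacing labels by their comparison with [k], the greedy sorting swaps
   exactly in the k x (n-k) rectangle of cells whose SW corner is the k-th vertex
   of the starting path; past this rectangle all is sorted, hence the comparisons
   of the position [e.2.1 - e.2.2 (+ 1)] with [n - k]. *)
Definition exceeds (k : nat) (e : edge) : bool :=
  let x := start_front F k in
  if e.1 then
    (e.2.2 < x - k%:Z) || ((x <= e.2.2) && (e.2.1 - e.2.2 <= n%:Z - k%:Z))
  else
    (x <= e.2.1) &&
    ((e.2.1 < x + n%:Z - k%:Z) || (e.2.1 - e.2.2 + 1 <= n%:Z - k%:Z)).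

(** The bound and the thresholds make each label a function of its edge alone, whatever the filling
    and the order of the sweep. *)
Definition labels (X : front) (f : nat -> nat) : Prop :=
  [/\ forall p, (p < n)%N -> (f p < n)%N,
      {in [pred p | p < n]%N &, injective f}
    & forall p k, (p < n)%N -> (0 < k < n)%N ->
        exceeds k (front_edge X p) = (k <= f p)%N].

Definition next_labels (l : nat) (f : nat -> nat) : nat -> nat :=
  if (0 < l < n)%N && (f l.-1 < f l)%N then swap_at l f else f.

Lemma labels_start : labels (start_front F) id.
Proof.
split=> // p k pn /andP[k0 kn]; have := start_step F pn.
have [kp|pk] := leqP k p.
  have : (k <= p <= n)%N by lia.
  move/(start_front_mono F); rewrite /exceeds /front_edge; case: eqP => ? /=; lia.
have : (p.+1 <= k <= n)%N by lia.
move/(start_front_mono F); rewrite /exceeds /front_edge; case: eqP => ? /=; lia.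
Qed.

(** No vertex of a front is strictly south-west of the [k]-th starting vertex, so the case analyses
    on [exceeds] can ignore that region. *)
Lemma swept_side X l k : swept F X -> (l <= n)%N -> (0 < k < n)%N ->
  start_front F k <= X l \/ start_front F k - k%:Z <= X l - l%:Z.
Proof.
move=> [_ bound _ _] ln kn; have := bound _ ln.
have [kl|lk] := leqP k l.
  by have := start_front_mono F (k := k) (l := l); lia.
by have := start_front_mono F (k := l) (l := k); lia.
Qed.

(** * Threshold comparisons at one cell *)

Section Cell.

Variables (X : front) (l k : nat).
Hypotheses (sw : swept F X) (c : corner F X l) (kn : (0 < k < n)%N).

(** For each threshold the cell is a comparator, sending the maximum north and the minimum east, as
    in the 0-1 principle. *)
Lemma exceeds_sorted : (0 < l < n)%N ->
  exceeds k (north_side (vertex X l)) =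
    exceeds k (west_side (vertex X l)) || exceeds k (south_side (vertex X l)) /\
  exceeds k (east_side (vertex X l)) =
    exceeds k (west_side (vertex X l)) && exceeds k (south_side (vertex X l)).
Proof.
move=> ln; have [ln' _ _ _] := c; have := swept_side sw ln' kn.
rewrite /exceeds /=; move: (start_front F k) (X l) => x y; lia.
Qed.

(** Bits already decreasing occur only past the rectangle, on the diagonal of its NE corner, where
    the sorted word changes from large to small labels. *)
Lemma exceeds_wasted : (0 < l < n)%N ->
  exceeds k (west_side (vertex X l)) -> ~~ exceeds k (south_side (vertex X l)) ->
  (k + l)%N = n.
Proof.
move=> ln; have [ln' _ _ _] := c; have := swept_side sw ln' kn.
rewrite /exceeds /=; move: (start_front F k) (X l) => x y; lia.
Qed.

Lemma exceeds_wall_NW : l = 0%N ->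
  exceeds k (east_side (vertex X l)) = exceeds k (south_side (vertex X l)).
Proof.
move=> ln; have [ln' _ _ _] := c; have := swept_side sw ln' kn.
rewrite /exceeds /=; move: (start_front F k) (X l) => x y; lia.
Qed.

Lemma exceeds_wall_SE : l = n ->
  exceeds k (north_side (vertex X l)) = exceeds k (west_side (vertex X l)).
Proof.
move=> ln; have [ln' _ _ _] := c; have := swept_side sw ln' kn.
rewrite /exceeds /=; move: (start_front F k) (X l) => x y; lia.
Qed.

End Cell.

Lemma swap_at_inj (T : Type) l (f : nat -> T) : (0 < l < n)%N ->
  {in [pred p | p < n]%N &, injective f} ->
  {in [pred p | p < n]%N &, injective (swap_at l f)}.
Proof.
move=> ln inj p q; rewrite !inE /swap_at => pn qn.
case: (p =P l.-1) => e1; case: (p =P l) => e2; case: (q =P l.-1) => e3;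
  case: (q =P l) => e4 // /inj; rewrite !inE; lia.
Qed.

Lemma labels_advance X l f : swept F X -> corner F X l -> labels X f ->
  labels (advance X l) (next_labels l f).
Proof.
move=> sw c [bd inj thr]; have [ln _ _ _] := c.
split.
- move=> p pn; rewrite /next_labels; case: ifP => [/andP[lin _]|_]; last exact: bd.
  by rewrite /swap_at; case: ifP => _; [|case: ifP => _]; apply: bd; lia.
- rewrite /next_labels; case: ifP => [/andP[lin _]|_] //; exact: swap_at_inj.
move=> p k pn kn; have [e|ne1] := eqVneq p.+1 l.
  subst l; rewrite (corner_north c) //.
  have tw := thr _ _ pn kn; rewrite (corner_west c) // in tw.
  have [ltn|nlt] := ltnP p.+1 n.
    have ts := thr _ _ ltn kn; rewrite (corner_south c) // in ts.
    have [-> _] := exceeds_sorted sw c kn ltn; rewrite tw ts /next_labels ltn /=.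
    by rewrite /swap_at; case: ifP => /=; rewrite ?eqxx; lia.
  rewrite (exceeds_wall_SE sw c kn) ?tw /next_labels; last by lia.
  by rewrite (ltnNge p.+1 n) nlt.
have [e|ne2] := eqVneq p l.
  subst l; rewrite (corner_east c) //.
  have ts := thr _ _ pn kn; rewrite (corner_south c) // in ts.
  have [p0|p0] := posnP p.
    by rewrite (exceeds_wall_NW sw c kn) // ts /next_labels p0.
  have pn' : (p.-1 < n)%N by lia.
  have tw := thr _ _ pn' kn; rewrite (corner_west c) // in tw.
  have pin : (0 < p < n)%N by lia.
  have [_ ->] := exceeds_sorted sw c kn pin; rewrite tw ts /next_labels pin /=.
  by rewrite /swap_at; case: ifP => /=; rewrite ?eqxx ?ifF; lia.
rewrite front_edge_advance // thr // /next_labels /swap_at; case: ifP => //.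
by move=> /andP[/andP[l0 _] _]; rewrite (negPf ne2) ifF //; lia.
Qed.

(* Each threshold separating the two labels is wasted on this cell, and
   [exceeds_wasted] recovers it from the level of the cell. *)
Lemma labels_descent X l f : swept F X -> corner F X l -> labels X f ->
  (0 < l < n)%N -> (f l <= f l.-1)%N -> f l.-1 = (f l).+1.
Proof.
move=> sw c [bd inj thr] lin le.
have pn' : (l.-1 < n)%N by lia.
have pn : (l < n)%N by lia.
have l0 : (0 < l)%N by lia.
have ne : f l <> f l.-1 by move/inj; rewrite !inE => /(_ pn pn'); lia.
have wasted k : (f l < k <= f l.-1)%N -> (k + l)%N = n.
  move=> kf; have kn : (0 < k < n)%N by have := bd _ pn'; lia.
  apply: (exceeds_wasted sw c kn lin).
    by rewrite -(corner_west c l0) thr //; lia.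
  by rewrite -(corner_south c pn) thr //; lia.
have := wasted (f l).+1; have := wasted (f l.-1); lia.
Qed.

(** * Greedy sorting dominates any other choice of swaps *)

Definition prefix_count (k : nat) (f : nat -> nat) (m : nat) : nat :=
  \sum_(0 <= p < m) (k <= f p)%N.

Lemma prefix_count_swap k f l m : (0 < l)%N -> m != l ->
  prefix_count k (swap_at l f) m = prefix_count k f m.
Proof.
rewrite /prefix_count; case: l => // l _; elim: m => [|m IH] ne.
  by rewrite !big_geq.
have [e|ne'] := eqVneq m l.+1.
  subst m; rewrite !big_nat_recr //= /swap_at /= eqxx ifF; last by lia.
  rewrite eqxx -!addnA [in LHS](addnC (k <= _)%N); congr addn.
  by apply: eq_big_nat => p pl; rewrite !ifF //; lia.
rewrite !big_nat_recr //= IH // /swap_at /= !ifF //; lia.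
Qed.

Lemma prefix_countS k f m :
  prefix_count k f m.+1 = (prefix_count k f m + (k <= f m)%N)%N.
Proof. by rewrite /prefix_count big_nat_recr. Qed.

Lemma eq_prefix_count k f g m : (forall p, (p < m)%N -> f p = g p) ->
  prefix_count k f m = prefix_count k g m.
Proof. by move=> H; apply: eq_big_nat => p /andP[_ /H ->]. Qed.

Lemma prefix_count_full k f m : (m <= prefix_count k f m)%N ->
  forall p, (p < m)%N -> (k <= f p)%N.
Proof.
elim: m => // m IH; rewrite prefix_countS => le p.
have : (prefix_count k f m <= m)%N.
  elim: {IH le} m => [|m IH]; first by rewrite /prefix_count big_geq.
  by rewrite prefix_countS; case: (k <= f m)%N; lia.
move=> lem; rewrite ltnS leq_eqVlt => /predU1P[->|]; last by apply: IH; lia.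
by move: le lem; case: (k <= f m)%N => //; lia.
Qed.

Definition dominates (f g : nat -> nat) : Prop :=
  forall k m, (m <= n)%N -> (prefix_count k g m <= prefix_count k f m)%N.

(** Only the prefix of length [l] changes. The greedy step makes its count the minimum of the count
    at [l - 1] plus one and the count at [l + 1]; any other choice stays below both. *)
Lemma dominates_next l f g (b : bool) : dominates f g ->
  dominates (next_labels l f)
    (if (0 < l < n)%N && b then swap_at l g else g).
Proof.
move=> dom k m mn; have [lin|lout] /= := boolP (0 < l < n)%N; last first.
  by rewrite /next_labels (negPf lout); apply: dom.
have l0 : (0 < l)%N by lia.
rewrite /next_labels lin /=.
have [e|ne] := eqVneq m l; last first.
  by case: ifP => _; case: ifP => _; rewrite ?prefix_count_swap //; apply: dom.
subst m; case: l lin l0 mn => // l lin _ mn.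
have pre (h : nat -> nat) : prefix_count k (swap_at l.+1 h) l = prefix_count k h l.
  by apply: eq_prefix_count => p pl; rewrite /swap_at !ifF //=; lia.
have d0 : (l <= n)%N by lia.
have d2 : (l.+2 <= n)%N by lia.
have := dom k _ d0; have := dom k _ d2.
have sw (h : nat -> nat) : swap_at l.+1 h l = h l.+1 by rewrite /swap_at eqxx.
rewrite !prefix_countS; case: ifP => hf; case: ifP => hb; rewrite ?pre ?sw /=;
  move: hf hb => /=;
  case: (leqP k (f l)); case: (leqP k (f l.+1)); case: (leqP k (g l));
  case: (leqP k (g l.+1)); lia.
Qed.

End Sorting.

(** * The comparison of noninversions *)

Section PairSum.

Variables (T : eqType) (w : T -> T -> bool).

Fixpoint pair_sum (s : seq T) : nat :=
  if s is x :: s' then (count (w x) s' + pair_sum s')%N else 0%N.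

Lemma pair_sum_eq0 s : (pair_sum s == 0)%N = pairwise (fun x y => ~~ w x y) s.
Proof.
elim: s => //= x s <-; rewrite addn_eq0; congr (_ && _).
by rewrite eqn0Ngt -has_count -all_predC.
Qed.

(** Pairs with one end among the two replaced entries need only be compared summed over both; [g]
    and [g'] absorb the change at the pair itself. *)
Lemma pair_sum_local g g' s1 x y x' y' s2 :
  (forall a, a \in s1 -> (w a x + w a y <= w a x' + w a y')%N) ->
  (forall b, b \in s2 -> (w x b + w y b <= w x' b + w y' b)%N) ->
  (w x y + g' <= w x' y' + g)%N ->
  (pair_sum (s1 ++ x :: y :: s2) + g' <= pair_sum (s1 ++ x' :: y' :: s2) + g)%N.
Proof.
move=> H1 H2 H3; elim: s1 H1 => [_|a s1 IH H1] /=.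
  have : (count (w x) s2 + count (w y) s2 <= count (w x') s2 + count (w y') s2)%N.
    elim: s2 H2 => //= b s2 IH H2; have := H2 b (mem_head _ _).
    have /IH : forall b, b \in s2 -> (w x b + w y b <= w x' b + w y' b)%N.
      by move=> b' b's; apply: H2; rewrite inE b's orbT.
    lia.
  lia.
have /IH : forall a, a \in s1 -> (w a x + w a y <= w a x' + w a y')%N.
  by move=> a' a's; apply: H1; rewrite inE a's orbT.
have := H1 a (mem_head _ _); rewrite !count_cat /=; lia.
Qed.

End PairSum.

Section Main.

Variables (n : nat) (F : alternating_shape n).
Hypothesis n1 : (1 < n)%N.

(** A default value for positions [n] and beyond. *)
Definition first_pipe : 'I_n := Ordinal (ltnW n1).

Definition start_pipes : nat -> 'I_n := insubd first_pipe.

Lemma start_pipesE p : (p < n)%N -> start_pipes p = p :> nat.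
Proof. by move=> pn; rewrite /start_pipes val_insubd pn. Qed.

Lemma carries_start P : carries F P (start_front F) start_pipes.
Proof.
move=> p pn; rewrite -(start_edgeE F (Ordinal pn)).
have -> : start_pipes p = Ordinal pn by apply/val_inj; rewrite /= start_pipesE.
exact: passes_start.
Qed.

Lemma carries_end P X g (w : 'S_n) (i : 'I_n) : carries F P X g ->
  (forall l, (l <= n)%N -> X l = end_front F l) -> exit_permutation F P w ->
  g i = w i.
Proof.
move=> cr fin exitw; have := cr i (ltn_ord i).
rewrite (@eq_front_edge X (end_front F)); [|by apply: fin; exact: ltnW|exact: fin].
by rewrite -end_edgeE => /passes_uniq; apply; exact: (exitw i).
Qed.

(** The greedy labels dominate the pipes of a dream sorting to the longest permutation, so they end
    decreasing too. Stated on edges alone, this serves sweeps of any other filling. *)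
Lemma exceeds_end k (p : 'I_n) : complete F -> (0 < k < n)%N ->
  exceeds F k (end_edge F p) = (k <= n - p.+1)%N.
Proof.
move=> [P [dream _ exitP]] kn.
pose J X := exists f g,
  [/\ labels F X f, carries F P X g & dominates n f (fun p => g p : nat)].
have [||X [sw fin [f [g [lab cr dom]]]]] := @sweep n F J n1.
- exists id, start_pipes; split; [exact: labels_start|exact: carries_start|].
  move=> k' m mn; rewrite (@eq_prefix_count k' _ id m) // => q qm.
  by rewrite start_pipesE //; lia.
- move=> X l sw c [f [g [lab cr dom]]].
  exists (next_labels n l f), (next_pipes P X l g); split.
  + exact: labels_advance.
  + exact: carries_advance.
  + move=> k' m mn; have := dominates_next l (is_cross (P (vertex X l))) dom k' mn.
    rewrite (_ : prefix_count k' (fun p => next_pipes P X l g p) m =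
      prefix_count k' (if (0 < l < n)%N && is_cross (P (vertex X l))
        then swap_at l (fun p => g p : nat) else (fun p => g p : nat)) m) //.
    apply: eq_prefix_count => q _; rewrite /next_pipes; case: ifP => // _.
    by rewrite /swap_at; case: ifP => // _; case: ifP.
have [bd inj thr] := lab.
have gE (q : 'I_n) : g q = (n - q.+1)%N :> nat.
  by rewrite (carries_end q cr fin exitP) permE.
(* The first [n - j] final positions of the witness hold pipes at least [j]; domination transfers
   this to the labels. *)
have top j q : (q < n - j)%N -> (j <= f q)%N.
  apply: prefix_count_full; apply: leq_trans (dom _ _ (leq_subr _ _)).
  suff all m : (m <= n - j)%N -> prefix_count j (fun p => g p) m = m by rewrite all.
  elim: m => [|m IH] mn; first by rewrite /prefix_count big_geq.
  have mn' : (m < n)%N by lia.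
  by rewrite prefix_countS IH ?(gE (Ordinal mn')) /=; lia.
have fE q : (q < n)%N -> f q = (n - q.+1)%N.
  elim/ltn_ind: q => q IH qn; have := top (n - q.+1)%N q; have := bd q qn.
  have [//|ne] := eqVneq (f q) (n - q.+1)%N.
  (* A label that is too large is, by induction, already used at the earlier position [r]. *)
  move=> fn le; pose r := (n - (f q).+1)%N.
  have rq : (r < q)%N by rewrite /r; lia.
  have rn : (r < n)%N by lia.
  have : f r = f q by rewrite IH // /r; lia.
  by move/inj; rewrite !inE => /(_ rn qn); lia.
rewrite end_edgeE -fE // -thr // (@eq_front_edge X (end_front F)) //.
  by apply: fin; exact: ltnW.
exact: fin.
Qed.

Lemma labels_end X f : complete F -> labels F X f ->
  (forall l, (l <= n)%N -> X l = end_front F l) ->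
  forall p, (p < n)%N -> f p = (n - p.+1)%N.
Proof.
move=> cF [bd _ thr] fin p pn.
have thrE k : (0 < k < n)%N -> (k <= f p)%N = (k <= n - p.+1)%N.
  move=> kn; rewrite -thr // (@eq_front_edge X (end_front F)).
  - by rewrite -(exceeds_end (Ordinal pn) cF kn) end_edgeE.
  - by apply: fin; exact: ltnW.
  - exact: fin.
have := bd p pn; have := thrE (f p); have := thrE (n - p.+1)%N; lia.
Qed.

(** * The potential of a set of pipes closed under contact arcs *)

Section Potential.

Variables (P : filling) (A : pred 'I_n).
Hypothesis dream : pipe_dream F P.
Hypothesis red : reduced F P.
Hypothesis closed : forall i j, contact_arc F P i j -> A i -> A j.

(** Summed over pairs, [pipe_weight] gives u and [label_weight] gives Phi. *)
Definition pipe_weight (x y : nat * 'I_n) : bool :=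
  [&& (x.2 < y.2)%N, A x.2 & ~~ A y.2].

Definition label_weight (x y : nat * 'I_n) : bool :=
  [&& (x.1 < y.1)%N, A x.2 & ~~ A y.2].

Definition word (f : nat -> nat) (g : nat -> 'I_n) : seq (nat * 'I_n) :=
  [seq (f p, g p) | p <- iota 0 n].

(* [c.1 < X l] says that [c] has already been swept. *)
Definition crossed (X : front) (g : nat -> 'I_n) : Prop :=
  forall p q, (p < q < n)%N -> (g q < g p)%N -> exists c l,
    [/\ (l <= n)%N, c.1 - c.2 = l%:Z, c.1 < X l & crosses_at F P (g q) (g p) c].

Definition balanced (X : front) : Prop := exists f g,
  [/\ labels F X f, carries F P X g, {in [pred p | p < n]%N &, injective g},
      crossed X g &
      (pair_sum pipe_weight (word f g) <= pair_sum label_weight (word f g))%N].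

Lemma word_split f g l : (0 < l < n)%N ->
  word f g = [seq (f p, g p) | p <- iota 0 l.-1]
    ++ [:: (f l.-1, g l.-1), (f l, g l)
         & [seq (f p, g p) | p <- iota l.+1 (n - l.+1)]].
Proof.
case: l => // l ln.
have iotaE : iota 0 n = iota 0 l ++ [:: l, l.+1 & iota l.+2 (n - l.+2)].
  by rewrite [in LHS](_ : n = l + (n - l.+2).+2)%N ?iotaD //; lia.
by rewrite /word iotaE map_cat.
Qed.

Lemma crosses_atC i j c : crosses_at F P i j c -> crosses_at F P j i c.
Proof. by case=> cF Pc H; split => //; case: H; [right|left]. Qed.

(** Pipes already inverted have crossed in a swept cell; reducedness would make it the current cell,
    which is not yet swept. *)
Lemma cross_increasing X l g : swept F X -> corner F X l -> (0 < l < n)%N ->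
  carries F P X g -> {in [pred p | p < n]%N &, injective g} -> crossed X g ->
  P (vertex X l) = Cross ->
  crosses_at F P (g l.-1) (g l) (vertex X l) /\ (g l.-1 < g l)%N.
Proof.
move=> sw c lin cr inj crs Pc.
have pn' : (l.-1 < n)%N by lia.
have pn : (l < n)%N by lia.
have l0 : (0 < l)%N by lia.
have cx : crosses_at F P (g l.-1) (g l) (vertex X l).
  split=> //; first exact: (corner_cell n1 sw c).
  by left; rewrite -(corner_west c l0) -(corner_south c pn); split; apply: cr.
split=> //; rewrite ltnNge leq_eqVlt; apply/negP => /orP[/eqP/val_inj/inj|lt].
  by rewrite !inE => /(_ pn pn'); lia.
have lt_l : (l.-1 < l < n)%N by lia.
have [c0 [m [mn cm ltX cx0]]] := crs _ _ lt_l lt.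
have ne : g l != g l.-1 by rewrite -val_eqE /= neq_ltn lt.
have := red ne cx0 (crosses_atC cx) => e; subst c0.
move: cm ltX; rewrite /vertex /= => cm; have -> : m = l by lia.
by rewrite ltxx.
Qed.

Lemma crossed_advance X l g : swept F X -> corner F X l -> carries F P X g ->
  {in [pred p | p < n]%N &, injective g} -> crossed X g ->
  crossed (advance X l) (next_pipes P X l g).
Proof.
move=> sw c cr inj crs.
have keep p q : (p < q < n)%N -> (g q < g p)%N -> exists c l',
    [/\ (l' <= n)%N, c.1 - c.2 = l'%:Z, c.1 < advance X l l'
      & crosses_at F P (g q) (g p) c].
  move=> pq lt; have [c0 [m [mn cm ltX cx]]] := crs _ _ pq lt.
  exists c0, m; split=> //; have [e|ne] := eqVneq m l.
    by subst m; rewrite advance_at; lia.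
  by rewrite advance_off.
rewrite /next_pipes; case: ifP => [/andP[lin]|_] //.
case Pc: (P _) => // _ p q pq.
have [cx lt] := cross_increasing sw c lin cr inj crs Pc.
have [ep|np] := eqVneq p l.-1; first have [eq|nq] := eqVneq q l.
- have -> : swap_at l g q = g l.-1.
    by rewrite /swap_at eq eqxx ifF //; lia.
  have -> : swap_at l g p = g l by rewrite /swap_at ep eqxx.
  move=> _; exists (vertex X l), l; split=> //=; [lia|lia|].
  by rewrite advance_at; lia.
- have -> : swap_at l g q = g q by rewrite /swap_at (negPf nq) ifF //; lia.
  have -> : swap_at l g p = g l by rewrite /swap_at ep eqxx.
  by apply: keep; lia.
have [ep'|np'] := eqVneq p l.
  have -> : swap_at l g q = g q by rewrite /swap_at !ifF //; lia.
  have -> : swap_at l g p = g l.-1 by rewrite /swap_at ep' eqxx ifF //; lia.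
  by apply: keep; lia.
have -> : swap_at l g p = g p by rewrite /swap_at (negPf np) (negPf np').
by rewrite /swap_at; case: ifP => ?; [|case: ifP => ?]; apply: keep; lia.
Qed.

Lemma balanced_advance X l : swept F X -> corner F X l -> balanced X ->
  balanced (advance X l).
Proof.
move=> sw c [f [g [lab cr inj crs le]]].
exists (next_labels n l f), (next_pipes P X l g); split.
- exact: labels_advance.
- exact: carries_advance.
- rewrite /next_pipes; case: ifP => // /andP[lin _]; exact: swap_at_inj.
- exact: crossed_advance.
have [lin|lout] := boolP (0 < l < n)%N; last first.
  by rewrite /next_labels /next_pipes (negPf lout).
have pn' : (l.-1 < n)%N by lia.
have pn : (l < n)%N by lia.
have l0 : (0 < l)%N by lia.
have desc := labels_descent sw c lab lin.
have [bd injf _] := lab.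
have off (T : Type) (h : nat -> T) p : p != l.-1 -> p != l -> swap_at l h p = h p.
  by move=> a b; rewrite /swap_at (negPf a) (negPf b).
have outside s : (forall p, p \in s -> p != l.-1 /\ p != l) ->
    [seq (next_labels n l f p, next_pipes P X l g p) | p <- s] =
    [seq (f p, g p) | p <- s].
  move=> H; apply/eq_in_map => p /H[a b].
  by rewrite /next_labels /next_pipes; case: ifP => _; case: ifP => _; rewrite ?off.
rewrite (word_split (next_labels _ _ _) _ lin) !outside; first last.
- by move=> p; rewrite mem_iota; lia.
- by move=> p; rewrite mem_iota; lia.
rewrite (word_split _ _ lin) in le.
set s1 := map _ (iota 0 _) in le *; set s2 := map _ (iota _ _) in le *.
have fresh a : (a \in s1) || (a \in s2) -> a.1 != f l.-1 /\ a.1 != f l.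
  move=> /orP[] /mapP[p]; rewrite mem_iota => pr -> /=.
    split; apply/eqP => /injf; rewrite !inE; lia.
  split; apply/eqP => /injf; rewrite !inE; lia.
have fresh1 a : a \in s1 -> a.1 != f l.-1 /\ a.1 != f l.
  by move=> h; apply: fresh; rewrite h.
have fresh2 a : a \in s2 -> a.1 != f l.-1 /\ a.1 != f l.
  by move=> h; apply: fresh; rewrite h orbT.
(* The drop of u at this cell. *)
pose good : nat := A (g l.-1) && ~~ A (g l).
have sw_l (T : Type) (h : nat -> T) : swap_at l h l = h l.-1.
  by rewrite /swap_at eqxx ifF //; lia.
have sw_l' (T : Type) (h : nat -> T) : swap_at l h l.-1 = h l.
  by rewrite /swap_at eqxx.
(* The chain is: new u + [good] <= old u <= old Phi <= new Phi + [good]. *)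
rewrite -(leq_add2r good); apply: leq_trans (_ : _ <= pair_sum label_weight
  (s1 ++ [:: (f l.-1, g l.-1), (f l, g l) & s2]))%N _; last first.
  rewrite -[leqLHS]addn0 /next_labels /next_pipes lin /=.
  case Pc: (P _) => /=; last first.
    have arc : A (g l.-1) -> A (g l).
      apply: closed; exists (vertex X l); split => //.
      - exact: (corner_cell n1 sw c).
      - by rewrite -(corner_west c l0); apply: cr.
      - by rewrite -(corner_south c pn); apply: cr.
    (* Pipes stay. If labels swap and the pipes are of different kinds, closure puts B west and A
       south: A gets the smaller label and B the larger, so Phi cannot drop. *)
    case: ifP => hf; apply: pair_sum_local => [a /fresh1[]|a /fresh2[]|];
      rewrite ?sw_l ?sw_l' /label_weight /good /=; move: hf arc desc;
      case: (A (g l.-1)); case: (A (g l)); try case: (A a.2); lia.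
  (* If the labels increase, they move with their pipes. Otherwise only the pipes swap, and the
     labels are consecutive: any other label compares alike with both. *)
  case: ifP => hf; apply: pair_sum_local => [a /fresh1[]|a /fresh2[]|];
      rewrite ?sw_l ?sw_l' /label_weight /good /=; move: hf desc;
      case: (A (g l.-1)); case: (A (g l)); try case: (A a.2); lia.
apply: leq_trans le; rewrite -[leqRHS]addn0.
rewrite /next_labels /next_pipes lin /=.
case Pc: (P _) => /=.
  have [_ lt] := cross_increasing sw c lin cr inj crs Pc.
  apply: pair_sum_local => [a _|a _|];
      rewrite ?sw_l ?sw_l' /pipe_weight /good /=; move: lt;
      case: (A (g l.-1)); case: (A (g l)); try case: (A a.2); lia.
have arc : A (g l.-1) -> A (g l).
  apply: closed; exists (vertex X l); split => //.
  - exact: (corner_cell n1 sw c).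
  - by rewrite -(corner_west c l0); apply: cr.
  - by rewrite -(corner_south c pn); apply: cr.
apply: pair_sum_local => [a _|a _|];
    rewrite ?sw_l ?sw_l' /pipe_weight /good /=; move: arc;
    case: (A (g l.-1)); case: (A (g l)); try case: (A a.2); lia.
Qed.

Lemma balanced_start : balanced (start_front F).
Proof.
exists id, start_pipes; split.
- exact: labels_start.
- exact: carries_start.
- move=> p q; rewrite !inE => pn qn /(congr1 val) /=.
  by rewrite !start_pipesE.
- by move=> p q pq; rewrite !start_pipesE; lia.
(* On the starting front labels and pipes coincide, so the two sums agree. *)
rewrite leq_eqVlt; apply/orP; left; apply/eqP.
have : all (fun x : nat * 'I_n => x.1 == x.2 :> nat) (word id start_pipes).
  by apply/allP => x /mapP[p + ->] /=; rewrite mem_iota => /start_pipesE ->.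
elim: (word _ _) => //= x s IH /andP[/eqP ex sE]; rewrite IH //; congr addn.
apply: eq_in_count => y /(allP sE) /eqP ey.
by rewrite /pipe_weight /label_weight ex ey.
Qed.

Lemma no_noninversion (w : 'S_n) p q : complete F -> exit_permutation F P w ->
  noninversion w p q -> A p -> A q.
Proof.
move=> cF exitw [pq inv] Ap; apply: contraT => nAq.
have [||X [sw fin [f [g [lab cr _ _ le]]]]] := @sweep n F balanced n1.
- exact: balanced_start.
- exact: balanced_advance.
have fE := labels_end cF lab fin.
have gE i := carries_end i cr fin exitw.
have sz : size (word f g) = n by rewrite size_map size_iota.
have nthE i : (i < n)%N -> nth (0%N, p) (word f g) i = (f i, g i).
  by move=> ltn; rewrite (nth_map 0%N) ?size_iota // nth_iota.
have : pair_sum label_weight (word f g) = 0%N.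
  apply/eqP; rewrite pair_sum_eq0; apply/(pairwiseP (0%N, p)) => i j.
  rewrite !inE sz => ltin ltjn ij; rewrite !nthE // /label_weight /= !fE //.
  by rewrite negb_and; apply/orP; left; lia.
move=> Phi0; move: le; rewrite Phi0 leqn0 pair_sum_eq0.
move=> /(pairwiseP (0%N, p)) /(_ ((w^-1)%g p) ((w^-1)%g q)).
rewrite !inE sz => /(_ (ltn_ord _) (ltn_ord _) inv).
by rewrite !nthE // /pipe_weight /= !gE !permKV pq Ap nAq.
Qed.

End Potential.

End Main.

Theorem theorem3p3 (n : nat) (hn : (2 <= n)%N) (F : alternating_shape n)
    (hF : complete F) (P : filling) (hP : pipe_dream F P) (hred : reduced F P)
    (w : 'S_n) (hw : exit_permutation F P w)
    (p q : 'I_n) (hpq : (p < q)%N) (hninv : noninversion w p q) :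
  contact_path F P p q.
Proof.
(* [p] is included so that [A p] holds; [q] differs from [p], so its membership gives a nonempty
   path. *)
pose reach i := i = p \/ contact_path F P p i.
pose A i : bool := if excluded_middle_informative (reach i) then true else false.
have AP i : A i <-> reach i by rewrite /A; case: excluded_middle_informative.
have closed i j : contact_arc F P i j -> A i -> A j.
  move=> arc /AP[e|pi]; apply/AP; right; first by subst i; apply: t_step.
  exact: t_trans pi (t_step _ _ _ _ arc).
have Ap : A p by apply/AP; left.
have /AP[e|//] := no_noninversion hn hP hred closed hF hw hninv Ap.
by move: hpq; rewrite e ltnn.
Qed.
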